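(* Let $n,\delta\in\mathbb{N}$ with $\delta\geq 3$ and $n\geq 6$. If $G$ is a connected $C_4$-free graph of order $n$ and minimum degree $\delta$, then \[\rho(G)-\pi(G)\leq \frac{5(n+1)}{4\left(\delta^2-2\lfloor\frac{\delta}{2}\rfloor +1\right)}+\frac{101}{20}.\]
   Context: All graphs are finite and simple. For a connected graph $G$ of order $n\ge 2$ and a vertex $v$, the average distance of $v$ is $\overline{\sigma}(v)=\frac{1}{n-1}\sum_{w\in V(G)}d(v,w)$, where $d$ is the shortest-path distance. The proximity is $\pi(G)=\min_{v}\overline{\sigma}(v)$ and the remoteness is $\rho(G)=\max_{v}\overline{\sigma}(v)$. A graph is $C_4$-free if it does not contain a $4$-cycle as a (not necessarily induced) subgraph. *)

(* Defs.v *)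
From mathcomp Require Import all_boot all_order all_algebra.
Set Implicit Arguments.
Unset Strict Implicit.
Unset Printing Implicit Defensive.
Import Order.TTheory GRing.Theory Num.Theory.

(* A finite simple graph is a symmetric irreflexive e : rel T on T : finType. *)

Definition simple_graph (T : finType) (e : rel T) : Prop :=
  symmetric e /\ irreflexive e.

Definition connected_graph (T : finType) (e : rel T) : Prop :=
  forall x y : T, connect e x y.

(* The cycle need not be induced: chords are allowed. *)
Definition C4_free (T : finType) (e : rel T) : Prop :=
  forall c : seq T, size c = 4 -> ~ ucycle e c.

(* Minimum and maximum of f over T; the default r0 is used only if T is empty. *)
Definition min_over (disp : Order.disp_t) (R : orderType disp) (T : finType)
    (r0 : R) (f : T -> R) : R :=
  \big[Order.min/head r0 (codom f)]_(r <- codom f) r.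

Definition max_over (disp : Order.disp_t) (R : orderType disp) (T : finType)
    (r0 : R) (f : T -> R) : R :=
  \big[Order.max/head r0 (codom f)]_(r <- codom f) r.

Definition degree (T : finType) (e : rel T) (v : T) : nat := #|[set w | e v w]|.

Definition min_degree (T : finType) (e : rel T) : nat := min_over 0 (degree e).

Definition has_path_of_length (T : finType) (e : rel T) (x y : T) (k : nat) : bool :=
  [exists p : k.-tuple T, [&& path e x p, uniq (x :: p) & last x p == y]].

(* The least k < #|T| such that there is a path of length k from x to y;
   it is #|T| if x and y are not connected, as paths have length < #|T|. *)
Definition dist (T : finType) (e : rel T) (x y : T) : nat :=
  find (has_path_of_length e x y) (iota 0 #|T|).

Local Open Scope ring_scope.

Definition avg_dist (T : finType) (e : rel T) (v : T) : rat :=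
  (#|T|%:R - 1)^-1 * \sum_(w : T) (dist e v w)%:R.

Definition proximity (T : finType) (e : rel T) : rat := min_over 0 (avg_dist e).

Definition remoteness (T : finType) (e : rel T) : rat := max_over 0 (avg_dist e).

(* Main.v *)
Require Import Defs.
From mathcomp Require Import all_boot all_order all_algebra.
From mathcomp Require Import zify ring lra.
Import Order.TTheory GRing.Theory Num.Theory.
Local Open Scope ring_scope.

(** Let [K = delta ^ 2 - 2 * (delta./2) + 1]. In a C4-free graph two distinct
    vertices have at most one common neighbour, so every ball of radius 2 has at
    least [K] vertices. Fix vertices [u], [v] at distance [l], and let [N i] be
    the size of the ball of radius [i] about [u]. Since
    [d(v,w) >= |d(u,w) - l|], the difference of the total distances of [u] and
    [v] is at most [n * l - 2 * \sum_(i < l) N i]. Disjoint balls of radius 2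
    about every fifth vertex of a geodesic from [u] to [v] give
    [N i >= K * (i - 1) / 5], and the resulting quadratic in [l] is at most
    [(5 * n + 3 * K) ^ 2 / (20 * K)]. *)

Set Implicit Arguments.
Unset Strict Implicit.

(** * Attained minima and maxima *)

Section Extrema.
Variables (disp : Order.disp_t) (R : orderType disp) (T : finType).
Variables (r0 : R) (f : T -> R) (x0 : T).

Lemma head_codom : head r0 (codom f) \in codom f.
Proof.
by have := codom_f f x0; case: (codom f) => // r s _; rewrite /= mem_head.
Qed.

Lemma max_over_attained : exists x, max_over r0 f = f x.
Proof.
suff /codomP[x ->] : max_over r0 f \in codom f by exists x.
rewrite /max_over big_seq.
apply: (big_ind (fun r => r \in codom f)) => // [|r s rf sf].
  exact: head_codom.
by rewrite maxEle; case: ifP.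
Qed.

Lemma min_over_attained : exists x, min_over r0 f = f x.
Proof.
suff /codomP[x ->] : min_over r0 f \in codom f by exists x.
rewrite /min_over big_seq.
apply: (big_ind (fun r => r \in codom f)) => // [|r s rf sf].
  exact: head_codom.
by rewrite minEle; case: ifP.
Qed.

Lemma min_over_le x : (min_over r0 f <= f x)%O.
Proof.
rewrite /min_over; move: (head _ _) (codom_f f x) => r1.
elim: (codom f) => // r s IHs; rewrite inE big_cons ge_min.
by case/predU1P => [->|/IHs ->]; rewrite ?lexx ?orbT.
Qed.

End Extrema.

(** Each edge inside [A] is counted from both ends. Ordering the ends by [enum_rank] splits the sum
    into two halves, equal after exchanging summations. *)
Lemma handshake (T : finType) (r : rel T) (A : {set T}) :
  symmetric r -> irreflexive r -> ~~ odd (\sum_(a in A) #|[set b in A | r a b]|).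
Proof.
move=> rS rI.
pose lt (a b : T) := (enum_rank a < enum_rank b)%N.
pose F (a b : T) : nat := lt a b && r a b.
have -> : (\sum_(a in A) #|[set b in A | r a b]| =
           \sum_(a in A) \sum_(b in A) F a b + \sum_(a in A) \sum_(b in A) F b a)%N.
  rewrite -big_split /=; apply: eq_bigr => a _.
  rewrite -big_split /= -sum1dep_card big_mkcondr /=; apply: eq_bigr => b _.
  rewrite /F /lt [r b a]rS; case: ltngtP => [||/val_inj/enum_rank_inj ->].
  - by case: (r a b).
  - by case: (r a b).
  - by rewrite rI.
by rewrite [X in (_ + X)%N]exchange_big /= addnn odd_double.
Qed.

(** * Distances and balls in a connected graph *)

Section Distance.
Variables (T : finType) (e : rel T).
Hypothesis (eS : symmetric e) (eC : connected_graph e).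

Lemma dist_le_path x p : path e x p -> (dist e x (last x p) <= size p)%N.
Proof.
move=> /shortenP[q xq Uq sub_qp].
have szq : (size q < #|T|)%N by have := max_card (mem (x :: q)); rewrite (card_uniqP Uq).
have le_qp : (size q <= size p)%N by apply: uniq_leq_size => //; case/andP: Uq.
apply: leq_trans le_qp; rewrite leqNgt; apply/negP => lt_q.
have := before_find 0%N lt_q; rewrite nth_iota // add0n => /negbT/negP[].
rewrite /has_path_of_length.
by apply/existsP; exists (in_tuple q); rewrite xq Uq /=.
Qed.

Lemma dist_path x y :
  exists p, [/\ path e x p, last x p = y & size p = dist e x y].
Proof.
have /connectP[p0 xp0 ->] := eC x y.
have : has (has_path_of_length e x (last x p0)) (iota 0 #|T|).
  move: xp0 => /shortenP[q xq Uq _]; apply/hasP; exists (size q).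
    have := max_card (mem (x :: q)); rewrite (card_uniqP Uq) /= => szq.
    by rewrite mem_iota.
  by apply/existsP; exists (in_tuple q); rewrite xq Uq /=.
move=> hx; have := nth_find 0%N hx; move: (hx); rewrite has_find size_iota => lt_f.
rewrite nth_iota // add0n => /existsP[p /and3P[xp _ /eqP lp]].
by exists p; rewrite size_tuple.
Qed.

Lemma dist0 x : dist e x x = 0%N.
Proof. by apply/eqP; rewrite -leqn0 (@dist_le_path x [::]). Qed.

Lemma dist_edge x y : e x y -> (dist e x y <= 1)%N.
Proof. by move=> exy; apply: (@dist_le_path x [:: y]); rewrite /= exy. Qed.

Lemma dist_triangle x y z : (dist e x z <= dist e x y + dist e y z)%N.
Proof.
have [p [xp lp <-]] := dist_path x y; have [q [yq <- <-]] := dist_path y z.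
by rewrite -lp -last_cat -size_cat dist_le_path // cat_path xp lp.
Qed.

Lemma dist_sym_le x y : (dist e y x <= dist e x y)%N.
Proof.
have [p [xp <- <-]] := dist_path x y.
have := xp; rewrite (eq_path (e' := fun a b => e b a)) => [|a b]; last exact: eS.
rewrite -rev_path => /dist_le_path; rewrite size_rev size_belast.
by case: p xp => [|a p] _ //=; rewrite rev_cons last_rcons.
Qed.

Lemma dist_sym x y : dist e x y = dist e y x.
Proof. by apply/eqP; rewrite eqn_leq !dist_sym_le. Qed.

(** The first [k] steps of a shortest path end at distance exactly [k], since a shortcut would also
    shorten the way to [y]. *)
Lemma geodesic_vertex x y k : (k <= dist e x y)%N -> exists z, dist e x z = k.
Proof.
have [p [xp lp szp]] := dist_path x y => le_k.
have := xp; rewrite -{1}(cat_take_drop k p) cat_path => /andP[xq zr].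
exists (last x (take k p)); apply/eqP; rewrite eqn_leq.
have := dist_le_path xq; rewrite size_takel ?szp // => -> /=.
have := dist_le_path zr; rewrite -last_cat cat_take_drop lp size_drop szp.
by have := dist_triangle x (last x (take k p)) y; lia.
Qed.

Definition ball x i := [set w | (dist e x w <= i)%N].

(** Double counting: [w] lies in the balls of radius [i] with [dist e x w <= i < l]. The subtraction
    is truncated, giving 0 for far [w]. *)
Lemma sum_card_ball x l :
  (\sum_(i < l) #|ball x i| = \sum_w (l - dist e x w))%N.
Proof.
transitivity (\sum_(i < l) \sum_w (dist e x w <= i : nat))%N.
  apply: eq_bigr => i _; rewrite -sum1dep_card big_mkcond.
  by apply: eq_bigr => w _; case: ifP.
rewrite exchange_big; apply: eq_bigr => w _ /=.
elim: l => [|l IHl]; first by rewrite big_ord0.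
by rewrite big_ord_recr /= IHl; lia.
Qed.

Lemma total_dist_le u v (l := dist e u v) :
  (\sum_w dist e u w + 2 * \sum_(i < l) #|ball u i| <= #|T| * l + \sum_w dist e v w)%N.
Proof.
rewrite sum_card_ball -sum_nat_const big_distrr -!big_split /=.
(* Vertex by vertex: if [d(u,w) <= l], use [l <= d(u,w) + d(w,v)]; otherwise the truncated term
   vanishes and [d(u,w) <= l + d(v,w)] suffices. *)
apply: leq_sum => w _.
have := dist_triangle u v w; have := dist_triangle u w v.
by rewrite (dist_sym w v) /l; lia.
Qed.

(** * Packing balls of radius 2 along a geodesic *)

Section Packing.
Variable (K : nat).
Hypothesis (ballK : forall x, (K <= #|ball x 2|)%N).

Lemma ball_packing u v j :
  (5 * j <= dist e u v)%N -> (j.+1 * K <= #|ball u (5 * j + 2)|)%N.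
Proof.
elim: j => [|j IHj] le_j; first by rewrite mul1n ballK.
have [z dz] := geodesic_vertex le_j.
have dis : [disjoint ball u (5 * j + 2) & ball z 2].
  rewrite disjoint_subset; apply/subsetP => w; rewrite !inE => uw.
  apply/negP => zw; have := dist_triangle u w z; rewrite (dist_sym w z) dz.
  by move: uw zw; lia.
have sub : ball u (5 * j + 2) :|: ball z 2 \subset ball u (5 * j.+1 + 2).
  apply/subsetP => w; rewrite !inE => /orP[uw|zw]; first by move: uw; lia.
  by have := dist_triangle u z w; rewrite dz; move: zw; lia.
apply: leq_trans (subset_leq_card sub).
rewrite cardsU disjoint_setI0 // cards0 subn0 mulSn addnC; apply: leq_add => //.
by apply: IHj; lia.
Qed.

Lemma card_ball_ge u v i :
  (i <= dist e u v)%N -> (K * i <= 5 * #|ball u i| + K)%N.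
Proof.
move=> le_i; case: (leqP i 1) => [|lt_i]; first by nia.
(* The largest [j] with [5 * j + 2 <= i]. *)
pose j := ((i - 2) %/ 5)%N.
have /ball_packing : (5 * j <= dist e u v)%N by lia.
have : (#|ball u (5 * j + 2)| <= #|ball u i|)%N.
  by apply/subset_leq_card/subsetP => w; rewrite !inE; lia.
have : (i <= 5 * j.+1 + 1)%N by lia.
by nia.
Qed.

(** Summing [card_ball_ge] over [i < l] gives [K * l * (l - 1) / 2] on the left, whence the
    coefficient 3. *)
Lemma sum_card_ball_ge u v (l := dist e u v) :
  (K * l ^ 2 <= 10 * \sum_(i < l) #|ball u i| + 3 * K * l)%N.
Proof.
have: (l <= dist e u v)%N by [].
elim: l => [|l IHl] le_l; first by rewrite big_ord0; lia.
rewrite big_ord_recr /=.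
have := card_ball_ge (ltnW le_l); have := IHl (ltnW le_l).
have -> : (K * l.+1 ^ 2 = K * l ^ 2 + 2 * (K * l) + K)%N by ring.
rewrite -!mulnA mulnS.
by move: (K * l ^ 2)%N (K * l)%N (\sum_(_ < _) _)%N #|_| => a b s c; lia.
Qed.

End Packing.
End Distance.

(** * Balls of radius 2 in a C4-free graph *)

Section C4Free.
Variables (T : finType) (e : rel T).
Hypothesis (simple : simple_graph e) (C4 : C4_free e).

Lemma common_neighbour x y : x != y -> (#|[set a | e x a && e y a]| <= 1)%N.
Proof.
have [eS eI] := simple => xy.
apply/card_le1_eqP => a b; rewrite !inE => /andP[xa ya] /andP[xb yb].
apply/eqP/negPn/negP => ab; apply: (C4 (c := [:: x; a; y; b])) => //.
have ne z w : e z w -> z != w by apply: contraTneq => ->; rewrite eI.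
have [ay bx] : e a y /\ e b x by rewrite !(eS _ y) !(eS _ x).
rewrite /ucycle /= xa ay yb bx !inE !negb_or xy (eq_sym a b) ab.
by rewrite (ne _ _ xa) (ne _ _ xb) (ne _ _ ay) (ne _ _ yb).
Qed.

(** Count walks of length 2 from [x] by endpoint: [#|A|] return to [x], [M] end in the neighbourhood
    [A], and at most one ends at each vertex of [B], those at distance 2. *)
Lemma card_ball2 x d :
  (2 <= d)%N -> (forall w, d <= degree e w)%N ->
  (d ^ 2 + 1 - 2 * d./2 <= #|ball e x 2|)%N.
Proof.
have [eS eI] := simple => d2 degd.
pose A := [set a | e x a]; pose common w := #|[set a | e x a && e w a]|.
have degA : (\sum_(a in A) degree e a = \sum_w common w)%N.
  transitivity (\sum_(a in A) \sum_w (e a w : nat))%N.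
    apply: eq_bigr => a _; rewrite /degree -sum1dep_card big_mkcond.
    by apply: eq_bigr => w _; case: ifP.
  rewrite exchange_big; apply: eq_bigr => w _ /=.
  rewrite /common -sum1dep_card big_mkcondr /=.
  by apply: eq_big => [a|a _]; rewrite ?inE // eS; case: ifP.
(* [M] is twice the number of edges inside [A]; its parity is the source of the floor in the
   bound. *)
pose M := (\sum_(a in A) #|[set b in A | e a b]|)%N.
have evenM : ~~ odd M by apply: handshake.
have MA : (\sum_(w in A) common w = M)%N.
  by apply: eq_bigr => w _; apply: eq_card => b; rewrite !inE.
have leMA : (M <= #|A|)%N.
  rewrite -MA -sum1_card; apply: leq_sum => w; rewrite inE => xw.
  by apply: common_neighbour; apply: contraTneq xw => <-; rewrite eI.
have xA : x \notin A by rewrite inE eI.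
have comx : common x = #|A| by apply: eq_card => a; rewrite !inE andbb.
pose B := ball e x 2 :\: (x |: A).
have sub : x |: A \subset ball e x 2.
  apply/subsetP => w; rewrite !inE => /predU1P[->|xw]; first by rewrite dist0.
  exact: leq_trans (dist_edge xw) _.
have cardB : (#|ball e x 2| = #|B| + #|A| + 1)%N.
  by rewrite -(cardsID (x |: A) (ball e x 2)) (setIidPr sub) cardsU1 xA -/B; lia.
have rest : (\sum_(w | (w != x) && (w \notin A)) common w <= #|B|)%N.
  rewrite -sum1_card [leqRHS]big_mkcond [leqLHS]big_mkcond /=; apply: leq_sum => w _.
  case: ifP => // /andP[wx wA].
  rewrite !inE negb_or wx; rewrite inE in wA; rewrite wA /=.
  case: ifPn => [_|far]; first by apply: common_neighbour; rewrite eq_sym.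
  rewrite leqn0 cards_eq0; apply/eqP/setP => a; rewrite !inE.
  apply: contraNF far => /andP[xa wa].
  by apply: (dist_le_path (p := [:: a; w])); rewrite /= xa eS wa.
have degAd : (d * #|A| <= #|A| + M + #|B|)%N.
  rewrite mulnC -sum_nat_const; apply: (@leq_trans (\sum_(a in A) degree e a)).
    by apply: leq_sum => a _.
  rewrite degA (bigD1 x) //= comx (bigID (mem A)) /= -addnA leq_add2l.
  apply: leq_add => //; rewrite -MA; apply: eq_leq.
  by apply: eq_bigl => w; rewrite andb_idl // => wA; apply: contraNneq xA => <-.
have dA : (d <= #|A|)%N by exact: degd x.
have M2 : (M <= 2 * #|A|./2)%N by lia.
(* If [#|A| = d], parity gives the exact bound; if [#|A| > d], [M <= #|A|] already gives at least
   [1 + (d - 1) * (d + 1) = d ^ 2]. *)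
have [eq_d|ne_d] := eqVneq #|A| d; first by move: M2 degAd; rewrite eq_d; nia.
by have : (d < #|A|)%N; [rewrite ltn_neqAle eq_sym ne_d | nia].
Qed.

End C4Free.

(** Eliminate [S], clear denominators and complete the square in [l]. *)
Lemma quadratic_bound (n K l S su sv : rat) :
  6 <= n -> 1 <= K -> K <= n ->
  su + 2 * S <= n * l + sv -> K * l ^+ 2 <= 10 * S + 3 * K * l ->
  (n - 1)^-1 * su - (n - 1)^-1 * sv <= (5 * (n + 1)) / (4 * K) + 101 / 20.
Proof.
move=> n6 K1 Kn le_s le_l.
have n1 : 0 < n - 1 by lra.
have K0 : 0 < K by lra.
rewrite -mulrBr mulrC ler_pdivrMr //.
have -> : ((5 * (n + 1)) / (4 * K) + 101 / 20) * (n - 1) =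
          ((n - 1) * (25 * (n + 1) + 101 * K)) / (20 * K) by field; lra.
rewrite ler_pdivlMr; last by lra.
have h1 : (su - sv) * 5 <= 5 * n * l + 3 * K * l - K * l ^+ 2 by lra.
have h2 : (su - sv) * (20 * K) <= 4 * K * (5 * n * l + 3 * K * l - K * l ^+ 2).
  have -> : (su - sv) * (20 * K) = 4 * K * ((su - sv) * 5) by ring.
  by apply: ler_wpM2l => //; lra.
apply: (le_trans h2).
have h3 : 4 * K * (5 * n * l + 3 * K * l - K * l ^+ 2) =
    (5 * n + 3 * K) ^+ 2 - (2 * K * l - (5 * n + 3 * K)) ^+ 2 by ring.
rewrite h3; have := sqr_ge0 (2 * K * l - (5 * n + 3 * K)).
(* What remains is [9 * K ^ 2 + 101 * K + 25 <= 71 * K * n], which follows from these two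
   products. *)
have : (K - 1) * (n - 6) >= 0 by apply: mulr_ge0; lra.
have : K * (n - K) >= 0 by apply: mulr_ge0; lra.
by nra.
Qed.

Unset Implicit Arguments.
Set Strict Implicit.

Theorem theorem3p4 (n delta : nat) (T : finType) (e : rel T)
    (hdelta : (3 <= delta)%N) (hn : (6 <= n)%N)
    (hsimple : simple_graph e) (hconn : connected_graph e) (hC4 : C4_free e)
    (horder : #|T| = n) (hmindeg : min_degree e = delta) :
  remoteness e - proximity e <=
    (5 * (n%:R + 1)) / (4 * (delta%:R ^+ 2 - 2 * (delta./2)%:R + 1)) + 101 / 20.
Proof.
have [eS eI] := hsimple.
have /card_gt0P[x0 _] : (0 < #|T|)%N by rewrite horder; lia.
have degd w : (delta <= degree e w)%N.
  by rewrite -hmindeg; have := min_over_le (R := nat) 0%N (degree e) w.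
(* Adding 1 before subtracting matches [card_ball2]; the natural subtraction is exact because
   [2 * delta./2 <= delta ^ 2 + 1]. *)
pose K := (delta ^ 2 + 1 - 2 * delta./2)%N.
have ballK x : (K <= #|ball e x 2|)%N by apply: card_ball2 => //; lia.
have [u ->] : exists u, remoteness e = avg_dist e u by exact: max_over_attained.
have [v ->] : exists v, proximity e = avg_dist e v by exact: min_over_attained.
have KE : delta%:R ^+ 2 - 2 * (delta./2)%:R + 1 = K%:R :> rat.
  by rewrite /K natrB ?natrD ?natrM ?natrX; [ring | nia].
rewrite KE /avg_dist horder -!natr_sum.
have := total_dist_le eS hconn u v; rewrite horder => le_s.
have le_l := sum_card_ball_ge eS hconn ballK u v.
apply: (@quadratic_bound _ _ (dist e u v)%:R
          (\sum_(i < dist e u v) #|ball e u i|)%:R).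
- by rewrite (ler_nat _ 6).
- by rewrite (ler_nat _ 1) /K; nia.
- by rewrite ler_nat -horder (leq_trans (ballK u)) ?max_card.
- by rewrite -!natrM -!natrD ler_nat.
- by rewrite -natrX -!natrM -!natrD ler_nat.
Qed.
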